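(* Let $(M,d)$ be a proper ultrametric pointed space. Then the Lipschitz-free space $\mathcal{F}(M)$ has the metric approximation property.
   Context: All spaces are real. A metric space is proper if every closed ball is compact. It is ultrametric if $d(x,z)\le\max\{d(x,y),d(y,z)\}$ for all points $x,y,z$. A pointed metric space $(M,d)$ is a metric space with a distinguished point (origin) $0\in M$. $Lip_0(M)$ is the Banach space of Lipschitz functions $f:M\to\mathbb{R}$ with $f(0)=0$, normed by the Lipschitz constant. For $x\in M$, $\delta_x\in Lip_0(M)^*$ is given by $\delta_x(f)=f(x)$; the Lipschitz-free space $\mathcal{F}(M)$ is the norm-closed linear span of $\{\delta_x: x\in M\}$ in $Lip_0(M)^*$. A Banach space $X$ has the metric approximation property if for every $\varepsilon>0$ and every compact $K\subset X$ there is a finite-rank bounded linear operator $T:X\to X$ with $\|T\|\le 1$ and $\|Tx-x\|<\varepsilon$ for every $x\in K$. *)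

(* Defs.v *)
From HB Require Import structures.
From mathcomp Require Import all_boot all_order all_algebra.
From mathcomp Require Import all_classical all_reals.
From mathcomp Require Import topology normedtype.

Set Implicit Arguments.
Unset Strict Implicit.
Unset Printing Implicit Defensive.

Import Order.TTheory GRing.Theory Num.Theory.
Import numFieldNormedType.Exports.

Local Open Scope classical_set_scope.
Local Open Scope ring_scope.

Section MetricSpaces.
Context {R : realType}.

(* The library's [closed_ball x r] is the closure of the open ball, which in an
   ultrametric space can be strictly smaller than the set used here. *)
Definition proper_metric (M : metricType R) : Prop :=
  forall (x : M) (r : R), compact [set y : M | mdist x y <= r].

Definition ultrametric (M : metricType R) : Prop :=
  forall x y z : M, mdist x z <= Num.max (mdist x y) (mdist y z).

End MetricSpaces.

Section Span.
Context {R : realType} {V : lmodType R}.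

Definition lin_span (A : set V) : set V :=
  [set v | exists n (a : 'I_n -> R) (x : 'I_n -> V),
     (forall i, A (x i)) /\ v = \sum_(i < n) a i *: x i].

Lemma lin_span0 (A : set V) : lin_span A 0.
Proof.
exists 0%N, (fun=> 0), (fun=> 0); split; first by case.
by rewrite big_ord0.
Qed.

Lemma lin_spanP (A : set V) (c : R) (u v : V) :
  lin_span A u -> lin_span A v -> lin_span A (c *: u + v).
Proof.
move=> [n [a [x [Ax ->]]]] [m [b [y [Ay ->]]]].
exists (n + m)%N,
  (fun i => match fintype.split i with inl j => c * a j | inr j => b j end),
  (fun i => match fintype.split i with inl j => x j | inr j => y j end); split.
  by move=> i; case: (fintype.split i).
rewrite big_split_ord scaler_sumr; congr (_ + _); apply: eq_bigr => i _.
  by rewrite -[lshift _ _]/(unsplit (inl i)) unsplitK scalerA.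
by rewrite -[rshift _ _]/(unsplit (inr i)) unsplitK.
Qed.

End Span.

Section BoundedOperators.
Context {R : realType} (V W : normedModType R).

Definition bounded_linear (f : V -> W) : Prop :=
  linear f /\ exists k : R, forall x, `|f x| <= k * `|x|.

Definition bounded_linear_pred : {pred V -> W} :=
  mem [set f : V -> W | bounded_linear f].

Record bop := Bop { bop_fun :> V -> W; _ : bop_fun \in bounded_linear_pred }.

HB.instance Definition _ := [isSub for bop_fun].
HB.instance Definition _ := [Choice of bop by <:].

Lemma bounded_linear_submod_closed : submod_closed bounded_linear_pred.
Proof.
split.
  rewrite inE; split; first by move=> c x y /=; rewrite scaler0 addr0.
  by exists 0 => x; rewrite mul0r normr0.
move=> c f g; rewrite !inE => -[lf [k kf]] [lg [l lg']]; split.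
  move=> a x y; rewrite !fctE lf lg.
  rewrite !scalerDr !scalerA (mulrC c) -!addrA; congr (_ + _).
  by rewrite addrCA.
exists (`|c| * k + l) => x; rewrite !fctE.
rewrite (le_trans (ler_normD _ _))// normrZ mulrDl lerD// -mulrA.
by rewrite ler_wpM2l.
Qed.

HB.instance Definition _ := GRing.isSubmodClosed.Build _ _ bounded_linear_pred
  bounded_linear_submod_closed.
HB.instance Definition _ := [SubChoice_isSubLmodule of bop by <:].

Lemma bop_linear (f : bop) : linear f.
Proof. by case: f => f /=; rewrite inE => -[]. Qed.

HB.instance Definition _ (f : bop) :=
  GRing.isLinear.Build R V W _ f (bop_linear f).

Lemma bop_bounded (f : bop) : exists k : R, forall x, `|f x| <= k * `|x|.
Proof. by case: f => f /=; rewrite inE => -[]. Qed.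

Lemma bopP (f g : bop) : f =1 g <-> f = g.
Proof. by split=> [fg|->//]; apply/val_inj/funext. Qed.

Lemma bopDE (f g : bop) x : (f + g) x = f x + g x. Proof. by []. Qed.
Lemma bopZE (c : R) (f : bop) x : (c *: f) x = c *: f x. Proof. by []. Qed.
Lemma bop0E x : (0 : bop) x = 0. Proof. by []. Qed.

Definition opnorm (f : bop) : R :=
  sup [set `|f x| | x in [set x : V | `|x| <= 1]].

Lemma opnorm_has_sup (f : bop) :
  has_sup [set `|f x| | x in [set x : V | `|x| <= 1]].
Proof.
split; first by exists `|f 0|, 0 => //=; rewrite normr0.
have [k fk] := bop_bounded f; exists `|k| => _ [x /= x1 <-].
rewrite (le_trans (fk x))// (le_trans (ler_norm _))// normrM normr_id.
by rewrite ler_piMr.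
Qed.

Lemma opnorm_le (f : bop) x : `|f x| <= opnorm f * `|x|.
Proof.
have [->|x0] := eqVneq x 0; first by rewrite linear0 !normr0 mulr0.
rewrite -ler_pdivrMr ?normr_gt0//.
apply: ub_le_sup; first by case: (opnorm_has_sup f).
exists (`|x|^-1 *: x) => /=; first by rewrite normfZV.
by rewrite linearZ/= normrZ normfV normr_id mulrC.
Qed.

Lemma opnorm_ge0 (f : bop) : 0 <= opnorm f.
Proof.
apply: ub_le_sup; first by case: (opnorm_has_sup f).
by exists 0; rewrite /= ?linear0 normr0.
Qed.

Lemma opnorm_lub (f : bop) (k : R) : 0 <= k ->
  (forall x, `|f x| <= k * `|x|) -> opnorm f <= k.
Proof.
move=> k0 fk; apply: ge_sup; first by case: (opnorm_has_sup f).
by move=> _ [x /= x1 <-]; rewrite (le_trans (fk x))// ler_piMr.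
Qed.

Lemma opnormD f g : opnorm (f + g) <= opnorm f + opnorm g.
Proof.
apply: opnorm_lub => [|x]; first by rewrite addr_ge0 ?opnorm_ge0.
by rewrite bopDE (le_trans (ler_normD _ _))// mulrDl lerD ?opnorm_le.
Qed.

Lemma opnormZ (c : R) f : opnorm (c *: f) = `|c| * opnorm f.
Proof.
apply/eqP; rewrite eq_le; apply/andP; split.
  apply: opnorm_lub => [|x]; first by rewrite mulr_ge0 ?opnorm_ge0.
  by rewrite bopZE normrZ -mulrA ler_wpM2l// opnorm_le.
have [->|c0] := eqVneq c 0; first by rewrite normr0 mul0r opnorm_ge0.
rewrite mulrC -ler_pdivlMr ?normr_gt0//; apply: opnorm_lub => [|x].
  by rewrite divr_ge0 ?opnorm_ge0.
rewrite mulrAC ler_pdivlMr ?normr_gt0// mulrC -normrZ -bopZE.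
exact: opnorm_le.
Qed.

Lemma opnorm0_eq0 f : opnorm f = 0 -> f = 0.
Proof.
move=> f0; apply/bopP => x; rewrite bop0E; apply/eqP.
by rewrite -normr_le0 -(mul0r `|x|) -f0 opnorm_le.
Qed.

HB.instance Definition _ := @Lmodule_isNormed.Build R bop
  opnorm opnormD opnormZ opnorm0_eq0.

Lemma bop_normE (f : bop) :
  `|f| = sup [set `|f x| | x in [set x : V | `|x| <= 1]].
Proof. by []. Qed.

Lemma ler_bop (f : bop) x : `|f x| <= `|f| * `|x|.
Proof. exact: opnorm_le. Qed.

Lemma bop_norm_le (f : bop) (k : R) : 0 <= k ->
  (forall x, `|f x| <= k * `|x|) -> `|f| <= k.
Proof. exact: opnorm_lub. Qed.

Definition finite_rank (T : bop) : Prop :=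
  exists2 A : set W, finite_set A & range T = lin_span A.

End BoundedOperators.
Arguments bounded_linear_pred {R} V W _ : assert.

Section BoundedOperatorsComplete.
Context {R : realType} (V : normedModType R) (W : completeNormedModType R).

Lemma bop_complete (F : set_system (bop V W)) :
  ProperFilter F -> cauchy F -> cvg F.
Proof.
move=> FF /cauchy_ballP cF.
have ptw x : cvg ((fun f : bop V W => f x) @ F).
  apply: cauchy_cvg; apply/cauchy_ballP => e e0.
  have d0 : 0 < e / (`|x| + 1) by rewrite divr_gt0// ltr_wpDl.
  have [[A B] /= [FA FB] AB] := cF _ d0.
  exists ((fun f : bop V W => f x) @` A, (fun f : bop V W => f x) @` B).
    by split => /=; [apply: filterS FA|apply: filterS FB] => f; exists f.
  move=> [_ _] /= [[f Af <-] [g Bg <-]].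
  have := AB (f, g) (conj Af Bg); rewrite -!ball_normE /= => fg.
  rewrite (_ : f x - g x = (f - g) x)//.
  rewrite (le_lt_trans (ler_bop _ _))//.
  rewrite (@le_lt_trans _ _ (`|f - g| * (`|x| + 1)))//.
    by rewrite ler_wpM2l// lerDl.
  by rewrite -ltr_pdivlMr// ltr_wpDl.
pose g x := lim ((fun f : bop V W => f x) @ F).
have Fg x : (fun f : bop V W => f x) @ F --> g x by exact: ptw.
have lg : linear g.
  move=> c x y.
  have cl : (fun f : bop V W => c *: f x + f y) @ F --> c *: g x + g y.
    by apply: cvgD; [apply: cvgZr|]; exact: Fg.
  have E : (fun f : bop V W => c *: f x + f y) = (fun f => f (c *: x + y)).
    by apply/funext => f; rewrite bop_linear.
  rewrite E in cl; exact: cvg_unique (Fg _) cl.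
have key e : 0 < e ->
    \forall f \near F, forall x, `|(f : bop V W) x - g x| <= e * `|x|.
  move=> e0; have [[A B] /= [FA FB] AB] := cF _ e0.
  apply: filterS FA => f Af x.
  have cfx : (fun h : bop V W => `|f x - h x|) @ F --> `|f x - g x|.
    by apply: cvg_norm; apply: cvgB; [exact: cvg_cst|exact: Fg].
  rewrite -(cvg_lim _ cfx)//; apply: limr_le; first by apply/cvg_ex; eexists; exact: cfx.
  apply: filterS FB => h Bh.
  have := AB (f, h) (conj Af Bh); rewrite -!ball_normE /= => fh.
  rewrite (_ : f x - h x = (f - h) x)// (le_trans (ler_bop _ _))//.
  by rewrite ler_wpM2r// ltW.
have gP : g \in bounded_linear_pred V W.
  rewrite inE; split => //.
  have [f fg] := filter_ex (key 1 ltr01).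
  exists (1 + `|f|) => x; rewrite mulrDl -(subrK (f x) (g x)).
  by rewrite (le_trans (ler_normD _ _))// lerD ?ler_bop// distrC.
apply/cvg_ex; exists (Bop gP); apply/cvgrPdist_le => e e0.
apply: filterS (key e e0) => f fg; apply: bop_norm_le => [|x]; first exact: ltW.
by rewrite (_ : (_ - f) x = g x - f x)// distrC.
Qed.

HB.instance Definition _ := Uniform_isComplete.Build (bop V W) bop_complete.

End BoundedOperatorsComplete.

Definition dual {R : realType} (V : normedModType R) := bop V R^o.


Section ClosedSpan.
Context {R : realType} {X : completeNormedModType R} (A : set X).

Definition closed_span_pred : {pred X} := mem (closure (lin_span A)).

Record closed_span :=
  ClosedSpan { closed_span_val :> X; _ : closed_span_val \in closed_span_pred }.

HB.instance Definition _ := [isSub for closed_span_val].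
HB.instance Definition _ := [Choice of closed_span by <:].

Lemma closed_span_submod_closed : submod_closed closed_span_pred.
Proof.
split; first by rewrite inE; apply: subset_closure; exact: lin_span0.
move=> c u v; rewrite !inE => Au Av B.
have : (fun z : X * X => c *: z.1 + z.2) @ (u, v) --> c *: u + v.
  by apply: cvgD; [apply: cvgZr; exact: cvg_fst|exact: cvg_snd].
move=> /[apply] -[[U1 U2] /= [/Au [x [Ax Ux]] /Av [y [Ay Uy]]] UB].
exists (c *: x + y); split; first exact: lin_spanP.
exact: (UB (x, y)).
Qed.

HB.instance Definition _ := GRing.isSubmodClosed.Build _ _ closed_span_pred
  closed_span_submod_closed.
HB.instance Definition _ := [SubChoice_isSubLmodule of closed_span by <:].

Definition closed_span_norm (u : closed_span) : R := `|val u|.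

Lemma closed_span_normD u v :
  closed_span_norm (u + v) <= closed_span_norm u + closed_span_norm v.
Proof. exact: ler_normD. Qed.

Lemma closed_span_normZ (c : R) u :
  closed_span_norm (c *: u) = `|c| * closed_span_norm u.
Proof. exact: normrZ. Qed.

Lemma closed_span_norm0_eq0 u : closed_span_norm u = 0 -> u = 0.
Proof. by move=> /normr0_eq0 u0; apply: val_inj. Qed.

HB.instance Definition _ := @Lmodule_isNormed.Build R closed_span
  closed_span_norm closed_span_normD closed_span_normZ closed_span_norm0_eq0.

Lemma closed_span_normE (u : closed_span) : `|u| = `|val u|.
Proof. by []. Qed.

Lemma closed_span_complete (F : set_system closed_span) :
  ProperFilter F -> cauchy F -> cvg F.
Proof.
move=> FF /cauchy_ballP cF.
have /cauchy_cvg/cvg_ex[l Fl] : cauchy ((val : closed_span -> X) @ F).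
  apply/cauchy_ballP => e /cF [[B C] /= [FB FC] BC].
  exists (val @` B, val @` C).
    by split => /=; [apply: filterS FB|apply: filterS FC] => f; exists f.
  move=> [_ _] /= [[f Bf <-] [g Cg <-]].
  by have := BC (f, g) (conj Bf Cg); rewrite -!ball_normE.
have lP : l \in closed_span_pred.
  rewrite inE.
  refine (@closed_cvg _ _ F _ (val : closed_span -> X)
    (closure (lin_span A)) _ _ l Fl); first exact: closed_closure.
  by apply: nearW => -[x /=]; rewrite inE.
apply/cvg_ex; exists (ClosedSpan lP); apply/cvgrPdist_le => e e0.
by move/cvgrPdist_le : Fl => /(_ e e0).
Qed.

HB.instance Definition _ :=
  Uniform_isComplete.Build closed_span closed_span_complete.

End ClosedSpan.

Section LipschitzFunctions.
Context {R : realType} {M : metricType R} (o : M).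

Definition lip0_pred : {pred M -> R} :=
  mem [set f : M -> R | f o = 0 /\
    exists k : R, forall x y, `|f x - f y| <= k * mdist x y].

Record lip0 := Lip0 { lip0_fun :> M -> R; _ : lip0_fun \in lip0_pred }.

HB.instance Definition _ := [isSub for lip0_fun].
HB.instance Definition _ := [Choice of lip0 by <:].

Lemma lip0_submod_closed : submod_closed (lip0_pred : {pred M -> R^o}).
Proof.
split.
  rewrite inE; split => //; exists 0 => x y.
  by rewrite mul0r (_ : _ - _ = 0) ?normr0//; exact: subrr.
move=> c f g; rewrite !inE => -[f0 [k kf]] [g0 [l lg]]; split.
  by rewrite !fctE f0 g0 scaler0 addr0.
exists (`|c| * k + l) => x y; rewrite !fctE opprD addrACA -scalerBr.
rewrite (le_trans (ler_normD _ _))// normrZ mulrDl lerD// -mulrA.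
by rewrite ler_wpM2l.
Qed.

HB.instance Definition _ := GRing.isSubmodClosed.Build R (M -> R^o) lip0_pred
  lip0_submod_closed.
HB.instance Definition _ := [SubChoice_isSubLmodule of lip0 by <:].

Lemma lip0_origin (f : lip0) : f o = 0.
Proof. by case: f => f /=; rewrite inE => -[]. Qed.

Lemma lip0_lipschitz (f : lip0) :
  exists k : R, forall x y, `|f x - f y| <= k * mdist x y.
Proof. by case: f => f /=; rewrite inE => -[]. Qed.

Lemma lip0P (f g : lip0) : f =1 g <-> f = g.
Proof. by split=> [fg|->//]; apply/val_inj/funext. Qed.

Lemma lip0DE (f g : lip0) x : (f + g) x = f x + g x. Proof. by []. Qed.
Lemma lip0ZE (c : R) (f : lip0) x : (c *: f) x = c * f x. Proof. by []. Qed.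
Lemma lip00E x : (0 : lip0) x = 0. Proof. by []. Qed.

Definition slopes (f : M -> R) : set R :=
  [set r | exists x y, x != y /\ r = `|f x - f y| / mdist x y].

(* If M is a singleton, [slopes f] is empty and its supremum is 0. *)
Definition lip_const (f : lip0) : R := sup (slopes f).

Lemma lip_const_ubound (f : lip0) : has_ubound (slopes f).
Proof.
have [k fk] := lip0_lipschitz f; exists k => _ [x [y [xy ->]]].
by rewrite ler_pdivrMr ?mdist_gt0.
Qed.

Lemma lip_const_le (f : lip0) x y : `|f x - f y| <= lip_const f * mdist x y.
Proof.
have [->|xy] := eqVneq x y; first by rewrite subrr normr0 mdistxx mulr0.
rewrite -ler_pdivrMr ?mdist_gt0//.
by apply: ub_le_sup; [exact: lip_const_ubound|exists x, y].
Qed.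

Lemma lip_const_ge0 (f : lip0) : 0 <= lip_const f.
Proof.
have [S0|/set0P[r Sr]] := eqVneq (slopes f) set0.
  by rewrite /lip_const S0 sup0.
case: (Sr) => x [y [xy rE]]; apply: le_trans (ub_le_sup (lip_const_ubound f) Sr).
by rewrite rE divr_ge0// mdist_ge0.
Qed.

Lemma lip_const_lub (f : lip0) (k : R) : 0 <= k ->
  (forall x y, `|f x - f y| <= k * mdist x y) -> lip_const f <= k.
Proof.
move=> k0 fk; have [S0|/set0P S0] := eqVneq (slopes f) set0.
  by rewrite /lip_const S0 sup0.
apply: ge_sup => // _ [x [y [xy ->]]].
by rewrite ler_pdivrMr ?mdist_gt0.
Qed.

Lemma lip_constD f g : lip_const (f + g) <= lip_const f + lip_const g.
Proof.
apply: lip_const_lub => [|x y]; first by rewrite addr_ge0 ?lip_const_ge0.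
rewrite !lip0DE opprD addrACA (le_trans (ler_normD _ _))//.
by rewrite mulrDl lerD ?lip_const_le.
Qed.

Lemma lip_constZ (c : R) f : lip_const (c *: f) = `|c| * lip_const f.
Proof.
apply/eqP; rewrite eq_le; apply/andP; split.
  apply: lip_const_lub => [|x y]; first by rewrite mulr_ge0 ?lip_const_ge0.
  by rewrite !lip0ZE -mulrBr normrM -mulrA ler_wpM2l// lip_const_le.
have [->|c0] := eqVneq c 0; first by rewrite normr0 mul0r lip_const_ge0.
rewrite mulrC -ler_pdivlMr ?normr_gt0//; apply: lip_const_lub => [|x y].
  by rewrite divr_ge0 ?lip_const_ge0.
rewrite mulrAC ler_pdivlMr ?normr_gt0// mulrC -normrM mulrBr -!lip0ZE.
exact: lip_const_le.
Qed.

Lemma lip_const0_eq0 f : lip_const f = 0 -> f = 0.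
Proof.
move=> f0; apply/lip0P => x; rewrite lip00E; apply/eqP.
rewrite -normr_le0 -(mul0r (mdist x o)) -f0.
by rewrite (le_trans _ (lip_const_le f x o))// lip0_origin subr0.
Qed.

HB.instance Definition _ := @Lmodule_isNormed.Build R lip0
  lip_const lip_constD lip_constZ lip_const0_eq0.

Lemma lip0_normE (f : lip0) : `|f| = sup (slopes f).
Proof. by []. Qed.

Lemma ler_lip0 (f : lip0) x y : `|f x - f y| <= `|f| * mdist x y.
Proof. exact: lip_const_le. Qed.

Lemma lip0_norm_le (f : lip0) (k : R) : 0 <= k ->
  (forall x y, `|f x - f y| <= k * mdist x y) -> `|f| <= k.
Proof. exact: lip_const_lub. Qed.

Lemma delta_subproof (x : M) :
  ((fun f : lip0 => f x : R^o) : lip0 -> R^o) \in bounded_linear_pred lip0 R^o.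
Proof.
rewrite inE; split => //; exists (mdist x o) => f.
by have := ler_lip0 f x o; rewrite lip0_origin subr0 mulrC.
Qed.

Definition delta (x : M) : dual lip0 := Bop (delta_subproof x).

Lemma deltaE x (f : lip0) : delta x f = f x. Proof. by []. Qed.

Definition free_space := closed_span (range delta).

End LipschitzFunctions.

Definition metric_approximation_property {R : realType}
    (X : completeNormedModType R) : Prop :=
  forall eps : R, 0 < eps -> forall K : set X, compact K ->
  exists T : bop X X,
    [/\ finite_rank T, `|T| <= 1 & forall x, K x -> `|T x - x| < eps].

(* Main.v *)
Require Import Defs.
From mathcomp Require Import all_boot all_order all_algebra.
From mathcomp Require Import all_classical all_reals ring.
From mathcomp Require Import topology normedtype sequences.

(** A 1-Lipschitz map [p : M -> M] fixing the origin induces an operator of norm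
    at most 1 on the free space, sending the evaluation at [x] to the
    evaluation at [p x], because precomposition with [p] does not increase
    Lipschitz constants; if [p] has finite range, this operator has finite rank
    ([retraction_operator]).

    In an ultrametric space such maps are plentiful.  Two closed balls of
    radius [s] are equal or disjoint, and collapsing each of them to one of its
    points does not increase distances: points in different balls are more than
    [s] apart, so moving each of them by at most [s] cannot push them further
    apart.  Sending everything outside the ball of radius [r] about the origin
    to the origin is harmless too, since a point outside is at least as far
    from any point inside as the latter is from the origin.  Properness makes
    the range finite, as finitely many balls of radius [s] cover the compact
    ball of radius [r] ([ultrametric_retraction]).

    With [s = 1 / (n + 1)] and [r = n + 1] the induced operators converge to
    the identity on every evaluation functional, hence, their norms being at
    most 1, at every point of the free space ([pointwise_approximation]), and
    for the same reason uniformly on compact sets ([compact_approximation]). *)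

Set Implicit Arguments.
Unset Strict Implicit.
Unset Printing Implicit Defensive.

Import Order.TTheory GRing.Theory Num.Theory.
Import numFieldNormedType.Exports.

Local Open Scope classical_set_scope.
Local Open Scope ring_scope.

(** * Compactness and linear spans *)

(** The finite subsets of [U] form a directed family, and near each point of
    [K] the values of [f] eventually belong to the members of this family;
    compactness makes the same member work for the whole of [K]. *)
Lemma locally_constant_finite_image (T : topologicalType) (U : Type)
    (f : T -> U) (K : set T) : compact K ->
  (forall x, K x -> \forall y \near x, f y = f x) -> finite_set (f @` K).
Proof.
move=> /compact_near_coveringP cK fK.
pose F : set_system (set U) :=
  filter_from finite_set (fun A => [set S | A `<=` S]).
have FF : Filter F.
  apply: filter_from_filter; first by exists set0; exact: finite_set0.
  move=> A B fA fB; exists (A `|` B); first by rewrite finite_setU.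
  by move=> S; rewrite /= subUset.
have [x Kx|A fA AP] := cK _ F (fun S y => S (f y)) FF.
  exists ([set y | f y = f x], [set S | S (f x)]) => /=; last first.
    by move=> [y S] /= [-> ].
  split; first exact: fK.
  by exists [set f x]; [exact: finite_set1|move=> S; exact].
by apply: sub_finite_set fA => _ [x Kx <-]; exact: AP.
Qed.

Lemma lin_span_gen (R : realType) (V : lmodType R) (A : set V) x :
  A x -> lin_span A x.
Proof.
move=> Ax; exists 1%N, (fun=> 1), (fun=> x); split=> //.
by rewrite big_ord1 scale1r.
Qed.

Lemma lin_span_sum (R : realType) (V : lmodType R) (A : set V) (I : eqType)
    (s : seq I) (a : I -> R) (x : I -> V) :
  (forall i, i \in s -> A (x i)) -> lin_span A (\sum_(i <- s) a i *: x i).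
Proof.
elim: s => [|i s IH] Ax; first by rewrite big_nil; exact: lin_span0.
rewrite big_cons; apply: lin_spanP.
  by apply/lin_span_gen/Ax; rewrite mem_head.
by apply: IH => j js; apply: Ax; rewrite in_cons js orbT.
Qed.

(** Moving [x] by at most [e / 3] changes [T n x - x] by at most [2 e / 3],
    whatever [n] is: pointwise convergence is therefore locally uniform. *)
Lemma compact_approximation (R : realType) (V : normedModType R)
    (T : nat -> bop V V) (K : set V) (e : R) :
  (forall n, `|T n| <= 1) -> (forall x, T ^~ x @ \oo --> x) ->
  0 < e -> compact K -> exists n, forall x, K x -> `|T n x - x| < e.
Proof.
move=> T1 Tx e0 /compact_near_coveringP cK.
have e3 : 0 < e / 3 by rewrite divr_gt0.
have [x Kx|n _ nP] := cK _ \oo (fun n x => `|T n x - x| < e) _; last first.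
  by exists n => x Kx; apply: nP => //=.
exists (ball x (e / 3), [set n | `|x - T n x| < e / 3]) => /=.
  split; first exact: nbhsx_ballx.
  by have /cvgrPdist_lt := Tx x; apply.
move=> [y n] /=; rewrite -ball_normE /= => -[xy Tnx].
have -> : T n y - y = T n (y - x) + (T n x - x) + (x - y).
  by rewrite linearB !addrA !subrK.
rewrite (le_lt_trans (ler_normD _ _))//.
have -> : e = e / 3 + e / 3 + e / 3 by field.
rewrite ltrD// (le_lt_trans (ler_normD _ _))// ltrD//; last by rewrite distrC.
rewrite (le_lt_trans (ler_bop _ _))// distrC.
by rewrite (le_lt_trans _ xy)// ler_piMl.
Qed.

(** * Operators on the free space *)

Section FreeSpace.
Context {R : realType} {M : metricType R} (o : M).
Implicit Types x y z : M.

Lemma free_space_ext (u v : free_space o) :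
  (forall f, val u f = val v f) -> u = v.
Proof. by move=> uv; apply/val_inj/bopP. Qed.

Lemma free_space_valE (a : R) (u v : free_space o) f :
  val (a *: u + v) f = a * val u f + val v f.
Proof. by rewrite linearD linearZ bopDE bopZE. Qed.

Lemma dirac_subproof x : delta o x \in closed_span_pred (range (delta o)).
Proof.
by apply/mem_set/subset_closure/lin_span_gen; exists x.
Qed.

Definition dirac x : free_space o := ClosedSpan (dirac_subproof x).

Lemma dirac_dist x y : `|dirac x - dirac y| <= mdist x y.
Proof.
apply: bop_norm_le; first exact: mdist_ge0.
by move=> f; rewrite mulrC; exact: ler_lip0.
Qed.

Lemma dirac_dense (u : free_space o) (e : R) : 0 < e ->
  exists2 v, lin_span (range dirac) v & `|u - v| < e.
Proof.
move=> e0.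
have /set_mem : val u \in closed_span_pred (range (delta o)) by exact: valP.
move=> /(_ _ (nbhsx_ballx _ _ e0)) [_ [[n [a [x [xP ->]]]]]].
have /choice[y yE] : forall i, exists y, delta o y = x i.
  by move=> i; have [y _ <-] := xP i; exists y.
rewrite -ball_normE /= => ue.
exists (\sum_i a i *: dirac (y i)).
  by exists n, a, (dirac \o y); split=> // i; exists (y i).
rewrite closed_span_normE raddfB raddf_sum /=.
by rewrite (eq_bigr _ (fun i _ => congr1 ( *:%R (a i)) (yE i))).
Qed.

Section Retraction.
Variables (p : M -> M) (s : R).
Hypotheses (s0 : 0 < s) (po : p o = o).
Hypothesis p_sep : forall x y, p x != p y -> s <= mdist x y.
Hypothesis p_lip : forall x y, mdist (p x) (p y) <= mdist x y.
Hypothesis p_fin : finite_set (range p).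

(** Distinct fibers of [p] are at distance at least [s], so their indicators are
    Lipschitz with constant [1 / s].  The fiber of the origin gets the zero
    function, since functions must vanish at the origin. *)
Lemma fiber_subproof z :
  (fun x => ((p x == z) && (z != o))%:R : R) \in lip0_pred o.
Proof.
apply/mem_set; split; first by rewrite po eq_sym andbN.
exists s^-1 => x y; have [->|pxy] := eqVneq (p x) (p y).
  by rewrite subrr normr0 mulr_ge0 ?mdist_ge0// invr_ge0 ltW.
apply: (@le_trans _ _ 1).
  by case: (_ && _); case: (_ && _);
    rewrite ?subrr ?subr0 ?sub0r ?normrN ?normr0 ?normr1.
by rewrite mulrC ler_pdivlMr// mul1r p_sep.
Qed.

Definition fiber z : lip0 o := Lip0 (fiber_subproof z).

Lemma precomp_subproof (f : lip0 o) : f \o p \in lip0_pred o.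
Proof.
apply/mem_set; split; first by rewrite /= po lip0_origin.
by exists `|f| => x y; rewrite (le_trans (ler_lip0 f (p x) (p y)))// ler_wpM2l.
Qed.

Definition precomp (f : lip0 o) : lip0 o := Lip0 (precomp_subproof f).

Lemma precomp_norm f : `|precomp f| <= `|f|.
Proof.
apply: lip0_norm_le => // x y.
by rewrite (le_trans (ler_lip0 f (p x) (p y)))// ler_wpM2l.
Qed.

(** The fiber of the origin contributes nothing on either side, as
    [f o = 0]. *)
Lemma precomp_fiber (N : seq M) f : uniq N -> range p = [set` N] ->
  precomp f = \sum_(z <- N) f z *: fiber z.
Proof.
move=> uN pN; apply/lip0P => x.
have -> : (\sum_(z <- N) f z *: fiber z) x = \sum_(z <- N) f z * fiber z x.
  by elim/big_rec2: _ => // z _ g _ <-.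
have pxN : p x \in N by suff : [set` N] (p x) by []; rewrite -pN; exists x.
rewrite (bigD1_seq (p x)) //=.
rewrite big1 => [|z /negPf zp]; last by rewrite eq_sym zp mulr0.
rewrite eqxx addr0; have [->|_] := eqVneq (p x) o; last by rewrite mulr1.
by rewrite lip0_origin mul0r.
Qed.

(** The operator is the adjoint of [precomp], restricted to the free space.
    Writing it as [u |-> \sum_z u (fiber z) *: dirac z], [z] running over the
    range of [p], shows at once that it takes its values in the free space and
    that they stay in a finite-dimensional subspace. *)
Lemma retraction_operator : exists T : bop (free_space o) (free_space o),
  [/\ finite_rank T, `|T| <= 1 & forall x, T (dirac x) = dirac (p x)].
Proof.
have /finite_seqP[N0 pN0] := p_fin.
pose N := undup N0; have uN : uniq N by exact: undup_uniq.
have pN : range p = [set` N].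
  by rewrite pN0; apply/seteqP; split=> z /=; rewrite mem_undup.
have [T [Tspan TE]] : exists T : free_space o -> free_space o,
    (forall u, lin_span (dirac @` range p) (T u)) /\
    (forall u f, val (T u) f = val u (precomp f)).
  exists (fun u : free_space o => \sum_(z <- N) val u (fiber z) *: dirac z).
  split=> u.
    by apply: lin_span_sum => z zN; exists z => //; rewrite pN.
  move=> f; rewrite (precomp_fiber f uN pN) linear_sum raddf_sum /=.
  rewrite (_ : bop_fun _ f = \sum_(z <- N) val u (fiber z) * f z); last first.
    by elim/big_rec2: _ => // z _ g _ <-.
  by apply: eq_bigr => z _; rewrite linearZ /= mulrC.
have linT : linear T.
  move=> a u v; apply: free_space_ext => f.
  by rewrite free_space_valE !TE free_space_valE.
have T1 u : `|T u| <= 1 * `|u|.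
  rewrite mul1r; apply: bop_norm_le => // f; rewrite TE.
  by rewrite (le_trans (ler_bop _ _))// ler_wpM2l// precomp_norm.
have Tb : T \in bounded_linear_pred (free_space o) (free_space o).
  by apply/mem_set; split=> //; exists 1.
have Tdirac x : Bop Tb (dirac x) = dirac (p x).
  by apply: free_space_ext => f; rewrite TE.
exists (Bop Tb); split=> //; last exact: bop_norm_le.
exists (dirac @` range p); first exact: finite_image.
apply/seteqP; split=> [_ [u _ <-]|_ [n [a [x [xP ->]]]]].
  exact: Tspan.
have /choice[y yE] : forall i, exists y, Bop Tb (dirac y) = x i.
  by move=> i; have [_ [y _ <-] <-] := xP i; exists y.
exists (\sum_i a i *: dirac (y i)) => //.
by rewrite linear_sum; apply: eq_bigr => i _; rewrite linearZ -yE.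
Qed.

End Retraction.

(** On the span of the evaluations the convergence comes from [dirac_dist]; the
    bound on the norms extends it to the closure. *)
Lemma pointwise_approximation (T : nat -> bop (free_space o) (free_space o))
    (p : nat -> M -> M) :
  (forall n, `|T n| <= 1) -> (forall n x, T n (dirac x) = dirac (p n x)) ->
  (forall x, (fun n => mdist (p n x) x) @ \oo --> (0 : R)) ->
  forall u, T ^~ u @ \oo --> u.
Proof.
move=> T1 Tp px u.
have Tspan v : lin_span (range dirac) v -> T ^~ v @ \oo --> v.
  move=> [m [a [x [xP ->]]]].
  have -> : T ^~ (\sum_(i < m) a i *: x i) =
      fun n => \sum_(i < m) a i *: T n (x i).
    by apply/funext => n; rewrite linear_sum; under eq_bigr do rewrite linearZ.
  apply: cvg_big => [|i _]; first exact: add_continuous.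
  apply: cvgZl_tmp; have [y _ <-] := xP i.
  apply/cvgrPdist_lt => e e0; move/cvgrPdist_lt : (px y) => /(_ e e0).
  apply: filterS => n; rewrite sub0r normrN ger0_norm ?mdist_ge0// => pe.
  by rewrite Tp distrC (le_lt_trans (dirac_dist _ _)).
apply/cvgrPdist_lt => e e0; have e3 : 0 < e / 3 by rewrite divr_gt0.
have [v vs uv] := dirac_dense u e3.
move/cvgrPdist_lt : (Tspan v vs) => /(_ _ e3); apply: filterS => n vT.
have -> : u - T n u = (u - v) + (v - T n v) + T n (v - u).
  by rewrite linearB !addrA !subrK.
have -> : e = e / 3 + e / 3 + e / 3 by field.
rewrite (le_lt_trans (ler_normD _ _))// ltrD//.
  by rewrite (le_lt_trans (ler_normD _ _))// ltrD.
rewrite (le_lt_trans (ler_bop _ _))// distrC.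
by rewrite (le_lt_trans _ uv)// ler_piMl.
Qed.

End FreeSpace.

(** * Retractions of ultrametric spaces *)

(** The map [p] sends a point of the ball of radius [r] to a chosen point of its
    ball of radius [s], and every other point to the origin. *)
Lemma ultrametric_retraction (R : realType) (M : metricType R) (o : M)
    (s r : R) : proper_metric M -> ultrametric M -> 0 < s -> s <= r ->
  exists p : M -> M, [/\ p o = o,
    (forall x y, p x != p y -> s <= mdist x y),
    (forall x y, mdist (p x) (p y) <= mdist x y),
    finite_set (range p) &
    forall x, mdist o x <= r -> mdist (p x) x <= s].
Proof.
move=> pM uM s0 sr.
have ball_eq (x y : M) : mdist x y <= s ->
    [set z | mdist x z <= s] = [set z | mdist y z <= s].
  move=> xy; apply/seteqP; split=> z /= h.
    by rewrite (le_trans (uM y x z))// ge_max h metric_sym xy.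
  by rewrite (le_trans (uM x y z))// ge_max h xy.
(* The choice depends on the ball only, hence is the same for all its points;
   the ball of the origin is treated apart to make [q] fix the origin. *)
pose q x := if mdist o x <= s then o else xget o [set z | mdist x z <= s].
have qo : q o = o by rewrite /q mdistxx (ltW s0).
have q_near x : mdist (q x) x <= s.
  rewrite /q; case: ifPn => // _; rewrite metric_sym.
  by apply: (@xgetI _ o [set z | mdist x z <= s] x); rewrite /= mdistxx ltW.
have q_eq x y : mdist x y <= s -> q x = q y.
  move=> xy; rewrite /q (ball_eq _ _ xy).
  have := congr1 (@^~ o) (ball_eq _ _ xy); rewrite /= !(metric_sym _ o).
  by move=> /is_true_inj ->.
have qr x : mdist o x <= r -> mdist o (q x) <= r.
  move=> xr; rewrite (le_trans (uM o x _))// ge_max xr metric_sym.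
  by rewrite (le_trans (q_near x)).
pose p x := if mdist o x <= r then q x else o.
have po : p o = o by rewrite /p mdistxx (le_trans (ltW s0) sr).
(* The two longest sides of the triangle [o], [x], [y] are equal. *)
have far x y : mdist o x <= r -> (mdist o y <= r) = false -> r < mdist x y.
  move=> xr /negbT; rewrite -!ltNge => yr.
  have := lt_le_trans yr (uM o x y); rewrite lt_max => /orP[|//].
  by rewrite ltNge xr.
have p_sep x y : p x != p y -> s < mdist x y.
  rewrite /p; case: ifP => xr; case: ifP => yr; last by rewrite eqxx.
  - by rewrite ltNge; apply: contra => /q_eq ->.
  - by move=> _; exact: le_lt_trans sr (far _ _ xr yr).
  - by move=> _; rewrite metric_sym; exact: le_lt_trans sr (far _ _ yr xr).
exists p; split=> //.
- by move=> x y /p_sep/ltW.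
- move=> x y; have [->|pxy] := eqVneq (p x) (p y).
    by rewrite mdistxx mdist_ge0.
  have sxy := ltW (p_sep _ _ pxy); move: pxy.
  rewrite /p; case: ifP => xr; case: ifP => yr; last by rewrite eqxx.
  + move=> _; rewrite (le_trans (uM _ x _))// ge_max (le_trans (q_near x) sxy).
    rewrite (le_trans (uM _ y _))// ge_max lexx metric_sym.
    by rewrite (le_trans (q_near y) sxy).
  + by move=> _; rewrite metric_sym (le_trans (qr _ xr))// ltW// far.
  + by move=> _; rewrite (le_trans (qr _ yr))// ltW// metric_sym far.
- apply: (@sub_finite_set _ _ (o |` (q @` [set x | mdist o x <= r]))).
    move=> _ [x _ <-]; rewrite /p; case: ifP => xr; last by left.
    by right; exists x.
  rewrite finite_setU; split; first exact: finite_set1.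
  apply: locally_constant_finite_image; first exact: pM.
  move=> x _; have := nbhsx_ballx x s s0; rewrite ballEmdist.
  by apply: filterS => y /= /ltW/q_eq.
- by move=> x xr; rewrite /p xr.
Qed.

(** * The metric approximation property *)

Theorem theorem3p1 (R : realType) (M : metricType R) (o : M) :
  proper_metric M -> ultrametric M ->
  metric_approximation_property (free_space o).
Proof.
move=> pM uM e e0 K cK.
have scale n : exists Tp : bop (free_space o) (free_space o) * (M -> M),
  [/\ finite_rank Tp.1, `|Tp.1| <= 1,
    (forall x, Tp.1 (dirac o x) = dirac o (Tp.2 x)) &
    forall x, mdist o x <= n.+1%:R -> mdist (Tp.2 x) x <= n.+1%:R^-1].
  have n0 : 0 < n.+1%:R^-1 :> R by rewrite invr_gt0.
  have [|p [po psep plip pfin pnear]] :=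
      @ultrametric_retraction _ _ o _ n.+1%:R pM uM n0.
    by rewrite (@le_trans _ _ 1)// ?invf_le1 ?ler1n.
  have [T [Tfin T1 Tdirac]] := retraction_operator n0 po psep plip pfin.
  by exists (T, p).
have [Tp TpP] := choice scale.
have [n nP] : exists n, forall x, K x -> `|(Tp n).1 x - x| < e.
  apply: (@compact_approximation _ _ (fun n => (Tp n).1)) => //.
    by move=> n; have [] := TpP n.
  apply: (@pointwise_approximation _ _ o _ (fun n => (Tp n).2)).
  - by move=> n; have [] := TpP n.
  - by move=> n; have [] := TpP n.
  move=> x.
  (* The bound [1 / (n + 1)] holds as soon as [n + 1] reaches [mdist o x]. *)
  apply: (@squeeze_cvgr _ _ _ _ (cst 0) (@harmonic R)); last 2 first.
  - exact: cvg_cst.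
  - exact: cvg_harmonic.
  near=> n; rewrite mdist_ge0 /=; have [_ _ _] := TpP n; apply.
  rewrite -nat1r -lerBlDl.
  by near: n; exact: nbhs_infty_ger.
by exists (Tp n).1; have [] := TpP n.
Unshelve. all: by end_near.
Qed.
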